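(* Let $\mathcal{M}$ be a positroid on $[n]$ without loops or coloops. Let $s\ge 1$ and let $E=[a_1,b_1]\cup\cdots\cup[a_s,b_s]\subseteq[n]$ be a disjoint union of $s$ cyclic intervals such that $a_1,b_1,a_2,b_2,\ldots,a_s,b_s$ are cyclically ordered, i.e. they appear in this order going around the circle $1\to 2\to\cdots\to n\to 1$ (with $a_i=b_i$ allowed). Then there exists a non-crossing partition $\Pi=T_1\sqcup\cdots\sqcup T_p$ of $[s]$ such that $$\operatorname{rk}(E)=\sum_{j=1}^{p}\operatorname{nbd}(E|_{T_j}).$$
   Context: Cyclic intervals: for $a,b\in[n]$, $[a,b]$ is the set $\{a,a+1,\ldots,b\}$ read cyclically modulo $n$ (so $[a,a]=\{a\}$), and $(a,b):=[n]\setminus[b,a]$. A positroid of rank $d$ on $[n]$ is a matroid whose bases are exactly the $d$-subsets $B\subseteq[n]$ such that the $d\times d$ minor on the columns $B$ of some fixed real $d\times n$ matrix of rank $d$, all of whose maximal minors are nonnegative, is nonzero. A loop is an element in no basis; a coloop is an element in every basis. $\operatorname{rk}(A)$ is the maximum of $|A\cap B|$ over bases $B$, and $\operatorname{rk}(\mathcal{M})=\operatorname{rk}([n])$. For cyclic endpoints $b,a$, let $m(b,a):=\min_{B}|B\cap(b,a)|$ over all bases $B$ of $\mathcal{M}$. For a subset $T=\{i_1<\cdots<i_m\}\subseteq[s]$, let $E|_T=\bigcup_{i\in T}[a_i,b_i]$ and define $\operatorname{nbd}(E|_T):=\operatorname{rk}(\mathcal{M})-\sum_{j=1}^{m} m(b_{i_j},a_{i_{j+1}})$,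 with $i_{m+1}=i_1$ (so for $m=1$ the single term is $m(b_{i_1},a_{i_1})$, the minimal number of basis elements in the complement of $[a_{i_1},b_{i_1}]$). A partition $T_1\sqcup\cdots\sqcup T_p$ of $[s]$ into nonempty blocks is non-crossing if there are no $x<y<z<w$ in $[s]$ with $x,z\in T_i$ and $y,w\in T_j$ for some $i\neq j$. *)

(* Defs.v *)
From mathcomp Require Import all_boot all_order all_algebra.
From mathcomp Require Import reals.

Set Implicit Arguments.
Unset Strict Implicit.
Unset Printing Implicit Defensive.

Import Order.TTheory GRing.Theory Num.Theory.

Local Open Scope ring_scope.

(* The ground set [n] = {1, ..., n} is rendered as 'I_n = {0, ..., n-1}, and
   likewise [s] as 'I_s. *)

Section Cyclic.
Variable n : nat.

Definition cyc_interval (a b : 'I_n) : {set 'I_n} :=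
  [set x : 'I_n | if (a <= b)%N then (a <= x <= b)%N
                  else (a <= x)%N || (x <= b)%N].

(* With this convention (a, a+1) is empty and (a, a) = [n] minus a. *)
Definition cyc_open_interval (a b : 'I_n) : {set 'I_n} :=
  ~: cyc_interval b a.

(* Weak cyclic order: some rotation of the sequence is nondecreasing. *)
Definition cyclically_ordered (c : seq 'I_n) : Prop :=
  exists k : nat, sorted leq (map val (rot k c)).

End Cyclic.

Record matroid (n : nat) := Matroid {
  bases : {set {set 'I_n}};
  bases_neq0 : bases != set0;
  bases_exchange : forall (B C : {set 'I_n}) (x : 'I_n),
    B \in bases -> C \in bases -> x \in B :\: C ->
    exists2 y, y \in C :\: B & y |: (B :\ x) \in bases
}.

Section MatroidTheory.
Variables (n : nat) (M : matroid n).

Definition loop (x : 'I_n) : Prop :=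
  forall B : {set 'I_n}, B \in bases M -> x \notin B.

Definition coloop (x : 'I_n) : Prop :=
  forall B : {set 'I_n}, B \in bases M -> x \in B.

Definition rk (A : {set 'I_n}) : nat := (\max_(B in bases M) #|A :&: B|)%N.

(* The default value n bounds all the cardinals and there is at least one
   basis, so this is the actual minimum over the bases. *)
Definition min_gap (b a : 'I_n) : nat :=
  \big[minn/n]_(B in bases M) #|B :&: cyc_open_interval b a|.

(* [enum T] lists T in increasing order, and [next] is the cyclic successor
   in that list: it sends i_j to i_(j+1) and i_m to i_1. *)
Definition nbd (s : nat) (a b : 'I_s -> 'I_n) (T : {set 'I_s}) : int :=
  (rk [set: 'I_n])%:Z - \sum_(i in T) (min_gap (b i) (a (next (enum T) i)))%:Z.

End MatroidTheory.

(* The columns of B are taken in increasing order, since [enum_val] is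
   increasing on subsets of 'I_n. *)
Definition max_minor (R : realType) (d n : nat) (A : 'M[R]_(d, n))
    (B : {set 'I_n}) (hB : #|B| = d) : R :=
  \det (colsub (fun j : 'I_d => enum_val (cast_ord (esym hB) j)) A).

Definition positroid (R : realType) (n : nat) (M : matroid n) : Prop :=
  exists (d : nat) (A : 'M[R]_(d, n)),
    [/\ \rank A = d,
        forall (B : {set 'I_n}) (hB : #|B| = d), 0 <= max_minor A hB &
        forall B : {set 'I_n},
          B \in bases M <-> exists hB : #|B| = d, max_minor A hB != 0].

Definition noncrossing (s : nat) (P : {set {set 'I_s}}) : Prop :=
  forall T U : {set 'I_s}, T \in P -> U \in P -> T != U ->
  ~ exists x y z w : 'I_s,
      [/\ (x < y)%N, (y < z)%N, (z < w)%N,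
          (x \in T) && (z \in T) & (y \in U) && (w \in U)].

(* Main.v *)
(* Fix a basis [B] with [#|B :&: E|] maximal, and join [x \in B] to [y \notin B]
   when [B - x + y] is a basis.  By the three-term Pluecker relations and total
   nonnegativity, crossing edges [x1 y1], [x2 y2] force the edges [x1 y2] and
   [x2 y1].  The blocks are the classes of intervals connected by edges.  They
   are non-crossing because crossing edges merge.  No edge joins some [x \in B]
   inside a gap of a block to some [y] outside it: such a chord would cross an
   edge of the block, and [x] would then be joined to the block.  Hence [B] meets
   each gap in as few elements as possible, so [nbd] of a block is the number of
   elements of [B] in it, and these numbers add up to [#|B :&: E| = rk E]. *)
Require Import Defs.
From mathcomp Require Import all_boot all_order all_algebra.
From mathcomp Require Import perm reals zify ring.

Set Implicit Arguments.
Unset Strict Implicit.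
Unset Printing Implicit Defensive.

Import Order.TTheory GRing.Theory Num.Theory.

Local Open Scope ring_scope.

(** * Minors with arbitrary column choices and the three-term Pluecker relation *)

Definition update (I : eqType) (T : Type) (f : I -> T) (i : I) (u : T) : I -> T :=
  fun k => if k == i then u else f k.

Section Minors.
Variables (R : comNzRingType) (d n : nat) (A : 'M[R]_(d, n)).
Implicit Types (f : 'I_d -> 'I_n).

Definition fminor f : R := \det (colsub f A).

Lemma eq_fminor f g : f =1 g -> fminor f = fminor g.
Proof. by move=> fg; congr (\det _); apply/matrixP=> i j; rewrite !mxE fg. Qed.

Lemma fminor_perm f (s : 'S_d) : fminor (f \o s) = (-1) ^+ s * fminor f.
Proof.
rewrite /fminor.
have -> : colsub (f \o s) A = col_perm s (colsub f A).
  by apply/matrixP=> i j; rewrite !mxE.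
by rewrite col_permE det_mulmx det_perm odd_permV mulrC.
Qed.

Lemma fminor_eq0 f i j : i != j -> f i = f j -> fminor f = 0.
Proof.
move=> nij fij; rewrite /fminor -det_tr.
by apply: (determinant_alternate nij) => k; rewrite !mxE fij.
Qed.

(** Cramer's rule: the cofactors along column [i] do not see the replaced column. *)
Lemma fminor_update f i u :
  fminor (update f i u) = (\adj (colsub f A) *m A) i u.
Proof.
rewrite /fminor (expand_det_col _ i) mxE.
apply: eq_bigr => k _; rewrite !mxE /update eqxx mulrC; congr (_ * _).
rewrite /cofactor; congr (_ * \det _).
apply/matrixP=> p q; rewrite !mxE.
by rewrite eq_sym (negPf (neq_lift _ _)).
Qed.

Lemma fminor_expand f k u :
  fminor f * A k u = \sum_j A k (f j) * fminor (update f j u).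
Proof.
have -> : fminor f * A k u = (colsub f A *m \adj (colsub f A) *m A) k u.
  by rewrite mul_mx_adj mul_scalar_mx mxE.
rewrite -mulmxA mxE; apply: eq_bigr => j _.
by rewrite mxE -fminor_update.
Qed.

Lemma fminor_plucker f i1 i2 u1 u2 : i1 != i2 ->
  fminor f * fminor (update (update f i1 u1) i2 u2) =
  fminor (update f i1 u1) * fminor (update f i2 u2)
  - fminor (update f i1 u2) * fminor (update f i2 u1).
Proof.
move=> n12; set g := update f i1 u1.
have n21 : i2 != i1 by rewrite eq_sym.
(* Expand the second minor along column [i2], then rewrite the entries of column [u2] by
   [fminor_expand]. *)
have -> : fminor f * fminor (update g i2 u2)
        = \sum_j fminor (update g i2 (f j)) * fminor (update f j u2).
  rewrite fminor_update mxE big_distrr /=.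
  under eq_bigr => k _ do rewrite mulrCA fminor_expand big_distrr /=.
  rewrite exchange_big /=; apply: eq_bigr => j _.
  rewrite [fminor (update g _ _)]fminor_update mxE big_distrl /=.
  by apply: eq_bigr => k _; rewrite mulrA.
(* For any other [j] the column [f j] occurs twice. The term [j = i1] is the subtracted product, its
   sign coming from a swap of two columns. *)
rewrite (bigD1 i2) //= (bigD1 i1) //= big1 ?addr0; last first.
  move=> j /andP[nj2 nj1]; rewrite (@fminor_eq0 _ i2 j) ?mul0r 1?eq_sym //.
  by rewrite /update eqxx (negPf nj2) /g /update (negPf nj1).
congr (_ * _ + _).
  by apply: eq_fminor => k; rewrite /update /g; case: eqP => // ->;
     rewrite /update (negPf n21).
rewrite mulrC -mulrN; congr (_ * _).
transitivity (fminor (update f i2 u1 \o tperm i1 i2)).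
  apply: eq_fminor => k /=; rewrite /update /g /update.
  case: tpermP => [->|->|/eqP k1 /eqP k2].
  - by rewrite (negPf n12) !eqxx.
  - by rewrite eqxx (negPf n12).
  - by rewrite (negPf k1) (negPf k2).
by rewrite fminor_perm odd_tperm n12 expr1 mulN1r.
Qed.

End Minors.

(** * Columns in increasing order *)

Lemma sorted_enum_ord n (B : {set 'I_n}) : sorted (relpre val ltn) (enum B).
Proof.
rewrite /enum_mem; apply: sorted_filter; first by move=> x y z; apply: ltn_trans.
by rewrite -sorted_map -enumT val_enum_ord iota_ltn_sorted.
Qed.

Lemma nth_enum_ord_lt n (B : {set 'I_n}) (x : 'I_n) p q : (p < q < #|B|)%N ->
  (nth x (enum B) p < nth x (enum B) q)%N.
Proof.
case/andP=> pq qB.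
have tr : transitive (relpre (val : 'I_n -> nat) ltn).
  by move=> y z w; apply: ltn_trans.
apply: (sorted_ltn_nth tr x (sorted_enum_ord B)); rewrite // inE -cardE //.
exact: ltn_trans pq qB.
Qed.

Lemma enum_val_ord_lt n (B : {set 'I_n}) (i j : 'I_#|B|) :
  (i < j)%N -> (enum_val i < enum_val j)%N.
Proof.
move=> ij; set x := enum_val i.
rewrite (enum_val_nth x j) {1}/x (enum_val_nth x i).
by apply: nth_enum_ord_lt; rewrite ij ltn_ord.
Qed.

(** The column order of [max_minor], so that [fminor A (sorted_cols hB)] unfolds to
    [max_minor A hB]. *)
Definition sorted_cols d n (B : {set 'I_n}) (hB : #|B| = d) : 'I_d -> 'I_n :=
  fun j => enum_val (cast_ord (esym hB) j).

(** Transfers facts about sorted minors to any column order, at the cost of a sign. *)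
Lemma sorted_cols_perm d n (f : 'I_d -> 'I_n) (hB : #|[set f j | j : 'I_d]| = d) :
  injective f -> exists s : 'S_d, f =1 sorted_cols hB \o s.
Proof.
move=> injf.
have memf j : f j \in [set f j | j : 'I_d] by apply: imset_f.
pose h j := cast_ord hB (enum_rank_in (memf j) (f j)).
have hK j : sorted_cols hB (h j) = f j.
  by rewrite /sorted_cols /h cast_ordK enum_rankK_in.
have injh : injective h.
  by move=> j k /(congr1 (sorted_cols hB)); rewrite !hK => /injf.
by exists (perm injh) => j /=; rewrite permE hK.
Qed.

(* Two chords of the circle with four distinct endpoints cross exactly when an
   odd number of these four comparisons hold. *)
Definition crossing n (u v x y : 'I_n) : bool :=
  (u < x)%N (+) (v < x)%N (+) (u < y)%N (+) (v < y)%N.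

(** * Signs of minors and crossing chords *)

Section TotallyNonnegative.
Variables (F : realFieldType) (d n : nat).
Implicit Types (f : 'I_d -> 'I_n).

(* Its maximal minors are all positive, so they serve as reference signs for
   the reorderings of the columns. *)
Definition vdm : 'M[F]_(d, n) := Vandermonde d (\row_(j < n) (j : nat)%:R).

Lemma fminor_vdm f :
  fminor vdm f = \prod_(p : 'I_d * 'I_d | (p.1 < p.2)%N) ((f p.2)%:R - (f p.1)%:R).
Proof.
have -> : fminor vdm f = \det (Vandermonde d (\row_j (f j : nat)%:R : 'rV[F]_d)).
  by congr (\det _); apply/matrixP => i j; rewrite !mxE.
rewrite det_Vandermonde pair_big_dep /=.
by apply: eq_bigr => p _; rewrite !mxE.
Qed.

Lemma fminor_vdm_sorted (B : {set 'I_n}) (hB : #|B| = d) :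
  0 < fminor vdm (sorted_cols hB).
Proof.
rewrite fminor_vdm; apply: prodr_gt0 => -[i j] /= ij.
by rewrite subr_gt0 ltr_nat; apply: enum_val_ord_lt.
Qed.

Lemma sgr_natB (k l : nat) : k != l ->
  Num.sg (l%:R - k%:R : F) = (-1) ^+ ~~ (k < l)%N.
Proof.
move=> kl; case: (ltnP k l) => kl'.
  by rewrite gtr0_sg ?expr0 // subr_gt0 ltr_nat.
by rewrite ltr0_sg ?expr1 // subr_lt0 ltr_nat ltn_neqAle eq_sym kl.
Qed.

(** Group the four Vandermonde products by pairs of indices. Every pair but [{i1, i2}] contributes a
    square; that pair contributes four differences, an odd number of them positive by the crossing
    hypothesis. *)
Lemma vdm_crossing f i1 i2 u1 u2 : i1 != i2 -> u1 != u2 -> injective f ->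
  (forall j, f j != u1) -> (forall j, f j != u2) ->
  crossing (f i1) u1 (f i2) u2 ->
  fminor vdm f * fminor vdm (update f i1 u1) * fminor vdm (update f i2 u2)
  * fminor vdm (update (update f i1 u1) i2 u2) < 0.
Proof.
move=> n12 u12 injf fu1 fu2 X.
have n21 : i2 != i1 by rewrite eq_sym.
rewrite !fminor_vdm -!big_split /=.
set q := (X in \prod_(p | _) X p).
pose p0 := if (i1 < i2)%N then (i1, i2) else (i2, i1).
have p0lt : (p0.1 < p0.2)%N.
  by rewrite /p0; case: (ltnP i1 i2) => //= le; rewrite ltn_neqAle le andbT.
rewrite (bigD1 p0) //= nmulr_rlt0.
  (* In a pair other than [{i1, i2}] at most one index is updated, so each difference occurs an even
     number of times. *)
  apply: prodr_gt0 => -[i j] /= /andP[ij np0].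
  have nz x y : x != y -> (x : nat)%:R - (y : nat)%:R != 0 :> F.
    by move=> xy; rewrite subr_eq0 eqr_nat.
  have pos (x y : F) : x != 0 -> y != 0 -> 0 < x * x * y * y.
    by move=> x0 y0; rewrite -mulrA -!expr2 mulr_gt0 // exprn_even_gt0.
  have neq : j != i by rewrite -val_eqE /= neq_ltn ij orbT.
  have fneq k l : k != l -> (f k)%:R - (f l)%:R != 0 :> F.
    by move=> kl; apply: nz; rewrite val_eqE (inj_eq injf).
  have fu1n k : (f k)%:R - u1%:R != 0 :> F by apply: nz; rewrite val_eqE fu1.
  have fu2n k : (f k)%:R - u2%:R != 0 :> F by apply: nz; rewrite val_eqE fu2.
  have u1fn k : u1%:R - (f k)%:R != 0 :> F by apply: nz; rewrite eq_sym val_eqE fu1.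
  have u2fn k : u2%:R - (f k)%:R != 0 :> F by apply: nz; rewrite eq_sym val_eqE fu2.
  rewrite /q /= /update.
  have [i1E|ni1] := eqVneq i i1; have [i2E|ni2] := eqVneq i i2;
    have [j1E|nj1] := eqVneq j i1; have [j2E|nj2] := eqVneq j i2; subst;
    rewrite ?eqxx // in n12 n21 ij neq np0 *;
    try (by rewrite ltnn in ij);
    try (by apply: pos; auto);
    try (by rewrite [X in 0 < X * _]mulrAC; apply: pos; auto).
  - by rewrite /p0 ij eqxx in np0.
  - by rewrite /p0 ltnNge ltnW //= eqxx in np0.
have : Num.sg (q p0) = -1.
  have sgq : Num.sg (q (i1, i2)) = -1.
    rewrite /q /= /update !eqxx (negPf n12) (negPf n21) !sgrM.
    rewrite !sgr_natB ?val_eqE ?(inj_eq injf) // 1?eq_sym //.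
    rewrite -!signr_addb.
    by move: X; rewrite /crossing; do 4!case: (_ < _)%N.
  (* Exchanging [i1] and [i2] negates all four factors. *)
  rewrite /p0; case: ifP => // _; rewrite -sgq; congr (Num.sg _).
  by rewrite /q /=; ring.
by move=> sg; rewrite -sgr_lt0 sg ltrN10.
Qed.

Variable A : 'M[F]_(d, n).
Hypothesis A_ge0 : forall (B : {set 'I_n}) (hB : #|B| = d), 0 <= fminor A (sorted_cols hB).

(** Sorting the columns multiplies both minors by the same sign, which cancels. *)
Lemma fminor_vdm_ge0 f : injective f -> 0 <= fminor A f * fminor vdm f.
Proof.
move=> injf.
have hB : #|[set f j | j : 'I_d]| = d by rewrite card_imset // card_ord.
have [s fs] := sorted_cols_perm hB injf.
rewrite !(eq_fminor _ fs) !fminor_perm mulrACA -expr2 sqrr_sign mul1r.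
by rewrite mulr_ge0 // ltW // fminor_vdm_sorted.
Qed.

Lemma update_inj f i u : injective f -> (forall j, f j != u) ->
  injective (update f i u).
Proof.
move=> injf fu j k; rewrite /update; case: eqP => [->|_]; case: eqP => [->|_] //.
- by move=> E; have := fu k; rewrite -E eqxx.
- by move=> E; have := fu j; rewrite E eqxx.
- by move/injf.
Qed.

(* If the conclusion failed, the Pluecker relation would make the product of
   the four minors below a nonzero square, against the signs in
   [vdm_crossing]. *)
Lemma fminor_crossing f i1 i2 u1 u2 : i1 != i2 -> u1 != u2 -> injective f ->
  (forall j, f j != u1) -> (forall j, f j != u2) ->
  crossing (f i1) u1 (f i2) u2 ->
  fminor A (update f i1 u1) != 0 -> fminor A (update f i2 u2) != 0 ->
  fminor A (update f i1 u2) != 0.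
Proof.
move=> n12 u12 injf fu1 fu2 X nz1 nz2; apply/negP => /eqP z.
have E := fminor_plucker A f u1 u2 n12.
rewrite z mul0r subr0 in E.
have inj1 := @update_inj f i1 u1 injf fu1.
have inj2 := @update_inj f i2 u2 injf fu2.
have inj12 : injective (update (update f i1 u1) i2 u2).
  by apply: update_inj => // j; rewrite /update; case: ifP.
move: (vdm_crossing n12 u12 injf fu1 fu2 X) (fminor_vdm_ge0 injf)
  (fminor_vdm_ge0 inj1) (fminor_vdm_ge0 inj2) (fminor_vdm_ge0 inj12).
move: (fminor vdm f) (fminor vdm (update f i1 u1)) (fminor vdm (update f i2 u2))
  (fminor vdm (update (update f i1 u1) i2 u2)) => V V1 V2 V12 Vneg h h1 h2 h12.
move: (fminor A f) (fminor A (update f i1 u1)) (fminor A (update f i2 u2))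
  (fminor A (update (update f i1 u1) i2 u2)) E nz1 nz2 h h1 h2 h12
  => D D1 D2 D12 E nz1 nz2 h h1 h2 h12.
have : 0 <= (D * D12) * (D1 * D2) * (V * V1 * V2 * V12).
  have -> : (D * D12) * (D1 * D2) * (V * V1 * V2 * V12) =
            (D * V) * (D1 * V1) * ((D2 * V2) * (D12 * V12)) by ring.
  by apply: mulr_ge0; apply: mulr_ge0.
rewrite E leNgt pmulr_rlt0 ?Vneg // -expr2 exprn_even_gt0 //.
by rewrite mulf_neq0.
Qed.

End TotallyNonnegative.

(** * Basis exchange in a positroid *)

Lemma imset_update d n (f : 'I_d -> 'I_n) i u : injective f ->
  [set update f i u j | j : 'I_d] = u |: ([set f j | j : 'I_d] :\ f i).
Proof.
move=> injf; apply/setP => x; rewrite !inE; apply/imsetP/orP.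
  case=> j _ ->; rewrite /update; have [_|ji] := eqVneq j i; first by left.
  by right; rewrite (inj_eq injf) ji imset_f.
case=> [/eqP ->|/andP[xi /imsetP[j _ xj]]].
  by exists i; rewrite // /update eqxx.
exists j; rewrite // /update; have [ji|//] := eqVneq j i.
by rewrite xj ji eqxx in xi.
Qed.

Section PositroidExchange.
Variables (R : realType) (n : nat) (M : matroid n).
Hypothesis M_pos : positroid R M.

Lemma positroid_card_basis :
  exists d, forall B : {set 'I_n}, B \in bases M -> #|B| = d.
Proof.
have [d [A [_ _ basesE]]] := M_pos.
by exists d => B /basesE[].
Qed.

Lemma positroid_crossing_exchange (B : {set 'I_n}) (x1 x2 y1 y2 : 'I_n) :
  B \in bases M -> x1 \in B -> x2 \in B -> y1 \notin B -> y2 \notin B ->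
  y1 |: (B :\ x1) \in bases M -> y2 |: (B :\ x2) \in bases M ->
  crossing x1 y1 x2 y2 -> y2 |: (B :\ x1) \in bases M.
Proof.
move=> BM x1B x2B y1B y2B e1 e2 X.
(* If [x1 = x2] or [y1 = y2], the conclusion is one of the two given swaps. *)
have [->//|x12] := eqVneq x1 x2.
have [<-//|y12] := eqVneq y1 y2.
have [d [A [_ A_ge0 basesE]]] := M_pos.
(* Column order affects only the sign of a minor, so nonvanishing depends only on the set of
   columns. *)
have fminorE g : injective g ->
    (fminor A g != 0) = ([set g j | j : 'I_d] \in bases M).
  move=> injg.
  have hB : #|[set g j | j : 'I_d]| = d by rewrite card_imset // card_ord.
  have [s gs] := sorted_cols_perm hB injg.
  rewrite (eq_fminor _ gs) fminor_perm mulf_eq0 signr_eq0 /=.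
  apply/idP/idP => [nz|/basesE[hB']]; first by apply/basesE; exists hB.
  by rewrite (eq_irrelevance hB' hB).
have [hB _] := (basesE B).1 BM.
pose f : 'I_d -> 'I_n := sorted_cols hB.
have injf : injective f by move=> i j /enum_val_inj /cast_ord_inj.
have imf : [set f j | j : 'I_d] = B.
  apply/eqP; rewrite eqEcard card_imset // card_ord hB leqnn andbT.
  by apply/subsetP => _ /imsetP[j _ ->]; apply: enum_valP.
have /imsetP[i1 _ x1E] : x1 \in [set f j | j : 'I_d] by rewrite imf.
have /imsetP[i2 _ x2E] : x2 \in [set f j | j : 'I_d] by rewrite imf.
have fN u : u \notin B -> forall j, f j != u.
  by move=> uB j; apply: contraNneq uB => <-; rewrite -imf imset_f.
have upd i u : u \notin B ->
    (fminor A (update f i u) != 0) = (u |: (B :\ f i) \in bases M).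
  move=> uB; rewrite fminorE ?imset_update ?imf //.
  by apply: update_inj => //; apply: fN.
rewrite x1E -upd //; apply: (@fminor_crossing _ _ _ A A_ge0 f i1 i2 y1 y2) => //.
- by apply: contra_neq x12 => i12; rewrite x1E x2E i12.
- exact: fN.
- exact: fN.
- by rewrite -x1E -x2E.
- by rewrite upd // -x1E.
- by rewrite upd // -x2E.
Qed.

End PositroidExchange.

(* Among the bases meeting [J] in fewer elements than [B], one closest to [B]
   differs from it inside [J] only by losing elements, so exchanging a lost
   element produces a forbidden swap. *)
Lemma basis_cap_min n (M : matroid n) (B J : {set 'I_n}) :
  B \in bases M ->
  (forall x y, x \in B :&: J -> y \notin B :|: J ->
     y |: (B :\ x) \notin bases M) ->
  forall C, C \in bases M -> (#|B :&: J| <= #|C :&: J|)%N.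
Proof.
move=> BM nswap C; have [k] := ubnP #|C :\: B|.
elim: k C => // k IHk C; rewrite ltnS => Ck CM.
(* If [C] has some [z] in [J] outside [B], exchanging [z] for an element of [B] brings [C] closer to
   [B] without enlarging its part in [J]. *)
have [CJ|[z]] := set_0Vmem ((C :\: B) :&: J); last first.
  rewrite inE => /andP[zCB zJ].
  have [w wBC C'M] := bases_exchange CM BM zCB.
  move: zCB wBC; rewrite !inE => /andP[zB zC] /andP[wC wB].
  have wz : w != z by apply: contraNneq wC => ->.
  apply: leq_trans (IHk (w |: (C :\ z)) _ C'M) _.
    apply: leq_trans Ck; rewrite [X in (_ < X)%N](cardsD1 z) !inE zB zC /= add1n ltnS.
    apply/subset_leq_card/subsetP => u; rewrite !inE.
    by have [->|_] := eqVneq u w; rewrite ?wB //= => /and3P[-> -> ->].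
  rewrite [leqRHS](cardsD1 z) !inE zC zJ /=.
  have : (w |: (C :\ z)) :&: J \subset w |: ((C :&: J) :\ z).
    by apply/subsetP => u; rewrite !inE; case: eqP => //=; rewrite andbA.
  move/subset_leq_card/leq_trans; apply.
  by rewrite cardsU1; case: (_ \notin _).
rewrite leqNgt; apply/negP => lt.
have /subsetPn[x] : ~~ (B :&: J \subset C :&: J).
  by apply: contraL lt => /subset_leq_card; rewrite leqNgt.
rewrite !inE => /andP[xB xJ]; rewrite xJ andbT => xC.
have xBC : x \in B :\: C by rewrite inE xC.
have [y] := bases_exchange BM CM xBC.
rewrite inE => /andP[yB yC]; apply/negP/nswap; rewrite !inE ?xB // negb_or yB /=.
by apply/negP => yJ; move/setP/(_ y): CJ; rewrite !inE yB yC yJ.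
Qed.

(** * Cyclic intervals and the cyclic order of their starts *)

Lemma mem_cyc_interval n (a b x : 'I_n) :
  (x \in cyc_interval a b) =
  ((a <= x) && (x <= b) || (b < a) && ((a <= x) || (x <= b)))%N.
Proof. by rewrite inE; case: leqP => ab /=; rewrite ?orbF //; lia. Qed.

(** With distinct endpoints all four comparisons are negated, which preserves parity. *)
Lemma crossing_sym n (u v x y : 'I_n) : u != x -> u != y -> v != x -> v != y ->
  crossing u v x y = crossing x y u v.
Proof. by rewrite /crossing -!val_eqE /=; lia. Qed.

(** The [else] branch is the wrap-around from the maximum of [T] to its minimum, singletons
    included. *)
Lemma next_enum_ord s (T : {set 'I_s}) (i j : 'I_s) : i \in T -> j \in T ->
  let i' := next (enum T) i in
  if (i < i')%N then (j <= i)%N || (i' <= j)%N else (i' <= j <= i)%N.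
Proof.
move=> iT jT; set e := enum T; set m := index i e.
have ie : i \in e by rewrite mem_enum.
have je : j \in e by rewrite mem_enum.
have lt_nth p q : (p < q < size e)%N -> (nth i e p < nth i e q)%N.
  by rewrite -cardE; apply: nth_enum_ord_lt.
have le_nth p q : (p <= q < size e)%N -> (nth i e p <= nth i e q)%N.
  case/andP; rewrite leq_eqVlt => /orP[/eqP->//|pq] qe.
  by apply/ltnW/lt_nth; rewrite pq.
have iE : nth i e m = i by rewrite nth_index.
have jE : nth i e (index j e) = j by rewrite nth_index.
have me : (m < size e)%N by rewrite index_mem.
have qe : (index j e < size e)%N by rewrite index_mem.
have i'E : next e i = if (m.+1 < size e)%N then nth i e m.+1 else nth i e 0.
  rewrite next_nth ie -/m; case: (e) me => // y p' /= mp.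
  case: ltnP => [lt|ge]; first by apply: set_nth_default.
  by rewrite nth_default.
rewrite /= -/e i'E; have [mS|mS] := ltnP m.+1 (size e).
  have := lt_nth m m.+1; rewrite ltnSn mS iE => -> //.
  case: (leqP (index j e) m) => jm.
    by have := le_nth (index j e) m; rewrite jm me iE jE => ->.
  by have := le_nth m.+1 (index j e); rewrite jm qe jE orbC => ->.
have mE : (size e = m.+1)%N by lia.
have h : (nth i e 0 <= i)%N by have := le_nth 0 m; rewrite me iE => ->.
rewrite ltnNge h /=.
have := le_nth 0 (index j e); rewrite qe jE => -> //.
by have := le_nth (index j e) m; rewrite iE jE me andbT; apply; rewrite -ltnS -mE.
Qed.

Lemma nth_flatten_pairs (T : Type) (r : seq T) (S : Type) (f g : T -> S) x0 y0 i :
  (i < size r)%N ->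
  nth x0 (flatten [seq [:: f z; g z] | z <- r]) i.*2 = f (nth y0 r i).
Proof. by elim: r i => // z r IHr [|i] //= /IHr. Qed.

Lemma nth_rotated (T : Type) (x0 : T) (c : seq T) k p : (p < size c)%N ->
  nth x0 (rot k c) (if (k <= p)%N then p - k else (size c - k) + p)%N = nth x0 c p.
Proof.
move=> pc; rewrite /rot nth_cat size_drop; case: (leqP k p) => kp.
  by rewrite ltn_sub2r ?(leq_ltn_trans kp) // nth_drop subnKC.
by rewrite ltnNge leq_addr /= addKn nth_take.
Qed.

(* Reading the indices cyclically from [t], the sequence [a] is nondecreasing. *)
Lemma cyclically_ordered_starts n s (a b : 'I_s -> 'I_n) :
  cyclically_ordered (flatten [seq [:: a i; b i] | i <- enum 'I_s]) ->
  exists t, forall i j : 'I_s, (i < j)%N ->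
    if (i < t <= j)%N then (a j <= a i)%N else (a i <= a j)%N.
Proof.
case=> k; set c := flatten _ => csorted.
(* The start [a l] has position [2 l] in the list, and [k <= 2 l] exactly when [uphalf k <= l];
   those indices come first after the rotation. *)
exists (uphalf k) => i j ij.
pose x0 := a i.
have size_c : size c = s.*2.
  by rewrite size_flatten /shape -map_comp sumnE big_map big_enum /= sum_nat_const card_ord muln2.
have cE (l : 'I_s) : nth x0 c l.*2 = a l.
  by rewrite (nth_flatten_pairs _ _ _ l) ?size_enum_ord // nth_ord_enum.
pose pos p := if (k <= p)%N then (p - k)%N else (size c - k + p)%N.
have posE (l : 'I_s) : nth x0 (rot k c) (pos l.*2) = a l.
  by rewrite nth_rotated ?cE // size_c ltn_double.
have le_nth p q : (p <= q < s.*2)%N ->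
    (nth x0 (rot k c) p <= nth x0 (rot k c) q)%N.
  move=> /andP[pq qs]; rewrite sorted_map in csorted.
  have tr : transitive (relpre (val : 'I_n -> nat) leq).
    by move=> x y z; apply: leq_trans.
  have rf : reflexive (relpre (val : 'I_n -> nat) leq) by move=> x /=.
  apply: (sorted_leq_nth tr rf x0 csorted) => //;
    by rewrite inE size_rot size_c // (leq_ltn_trans pq).
have is_ := ltn_ord i; have js := ltn_ord j.
have uE : ((uphalf k).*2 = odd k + k)%N.
  by rewrite uphalf_half doubleD addnC -{3}(odd_double_half k); lia.
rewrite -(posE i) -(posE j); case: ifP => H; apply: le_nth;
  by move: H uE; rewrite /pos size_c; case: (odd k);
    case: (leqP k i.*2); case: (leqP k j.*2); lia.
Qed.

Section CyclicIntervals.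
Variables (n s : nat) (a b : 'I_s -> 'I_n).
Hypothesis ab_disj : forall i j : 'I_s, i != j ->
  [disjoint cyc_interval (a i) (b i) & cyc_interval (a j) (b j)].
Hypothesis ab_cyc :
  cyclically_ordered (flatten [seq [:: a i; b i] | i <- enum 'I_s]).

Let I i := cyc_interval (a i) (b i).

Lemma start_mem i : a i \in I i.
Proof. by rewrite mem_cyc_interval; lia. Qed.

Lemma stop_mem i : b i \in I i.
Proof. by rewrite mem_cyc_interval; lia. Qed.

Lemma mem_interval_inj i j x : x \in I i -> x \in I j -> i = j.
Proof.
move=> xi xj; apply/eqP; apply: contraT => /ab_disj d.
by move: xj; rewrite /I (disjointFr d xi).
Qed.

Lemma interval_notin i j x : i != j -> x \in I i -> x \notin I j.
Proof. by move=> ij xi; apply: contra_neqN ij => /(mem_interval_inj xi). Qed.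

(** Disjointness makes the starts distinct, so the weak comparisons become exact. *)
Lemma starts_cyclic : exists t, forall i j : 'I_s, (i < j)%N ->
  (a j < a i)%N = (i < t <= j)%N /\ (a i < a j)%N = ~~ (i < t <= j)%N.
Proof.
have [t tP] := cyclically_ordered_starts ab_cyc; exists t => i j ij.
have aN : (a i : nat) != a j.
  have nij : i != j by rewrite -val_eqE /= neq_ltn ij.
  apply/eqP => /val_inj E; have := interval_notin nij (start_mem i).
  by rewrite E start_mem.
by have := tP i j ij; case: (_ && _); lia.
Qed.

Lemma crossing_starts (x y z w : 'I_s) : (x < y)%N -> (y < z)%N -> (z < w)%N ->
  crossing (a x) (a z) (a y) (a w).
Proof.
move=> xy yz zw; have [t tP] := starts_cyclic.
have xw := ltn_trans xy (ltn_trans yz zw).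
rewrite /crossing (tP x y xy).2 (tP y z yz).1 (tP x w xw).2 (tP z w zw).2 !(leqNgt t).
have := @ltn_trans y x t xy; have := @ltn_trans z y t yz.
have := @ltn_trans w z t zw.
(* The indices below [t] form an initial segment of [x, y, z, w]; [H1], [H2], [H3] discard all other
   cases. *)
by case: (x < t)%N; case: (y < t)%N; case: (z < t)%N; case: (w < t)%N => //= H1 H2 H3;
  solve [by have := H1 isT | by have := H2 isT | by have := H3 isT].
Qed.

(** The correction term records that the interval wraps around and [x] lies past the wrap. It does
    not depend on [u], so it cancels for two outside points: a chord between them leaves the whole
    interval on one side. *)
Lemma interval_side i u x : u \notin I i -> x \in I i ->
  (u < x)%N = (u < a i)%N (+) ((b i < a i) && (x <= b i))%N.
Proof.
rewrite !mem_cyc_interval; case: (ltnP (b i) (a i)) => ab /=; last by rewrite addbF; lia.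
by case: (leqP x (b i)); rewrite ?addbT ?addbF; lia.
Qed.

Lemma interval_one_side i u v x : u \notin I i -> v \notin I i -> x \in I i ->
  (u < x)%N (+) (v < x)%N = (u < a i)%N (+) (v < a i)%N.
Proof.
move=> ui vi xi; rewrite (interval_side ui xi) (interval_side vi xi).
by rewrite addbACA addbb addbF.
Qed.

(** * Gaps between consecutive intervals of a block *)

Section Block.
Variable T : {set 'I_s}.
Let nxt := next (enum T).
Definition gap i := cyc_open_interval (b i) (a (nxt i)).

Lemma next_mem i : (nxt i \in T) = (i \in T).
Proof. by have := mem_next (enum T) i; rewrite !mem_enum. Qed.

(** The chord leaves the gap, so the two intervals bounding the gap lie on opposite sides of it. For
    a singleton block the hypotheses on [v] are contradictory. *)
Lemma gap_separated i u v : i \in T -> (forall k, k \in T -> u \notin I k) ->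
  (forall k, k \in T -> v \notin I k) -> u \in gap i -> v \notin gap i ->
  crossing u v (a i) (a (nxt i)).
Proof.
move=> iT uT vT.
have i'T : nxt i \in T by rewrite next_mem.
have := uT i iT; have := uT _ i'T; have := vT i iT; have := vT _ i'T.
rewrite /gap /cyc_open_interval !in_setC /crossing.
have [->|ni] := eqVneq (nxt i) i; first by rewrite !mem_cyc_interval; lia.
(* The endpoints of either interval lie outside the other; [lia] needs no more of disjointness. *)
have := interval_notin ni (start_mem _); have := interval_notin ni (stop_mem _).
rewrite eq_sym in ni.
have := interval_notin ni (start_mem _); have := interval_notin ni (stop_mem _).
by rewrite !mem_cyc_interval; lia.
Qed.

Hypothesis T_neq0 : T != set0.

(** The walk through the block winds around the circle once, descending only from the largest start.
    The weak inequality makes a singleton block count one as well. *)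
Lemma sum_descents : (\sum_(i in T) (a (nxt i) <= a i) = 1)%N.
Proof.
have [i0 i0T] := set0Pn _ T_neq0.
case: (@arg_maxnP _ i0 (mem T) (fun i => a i : nat) i0T) => j jT jmax.
have {}jmax i : i \in T -> (a i <= a j)%N := jmax i.
have [t tP] := starts_cyclic.
rewrite (bigD1 j) //= (jmax (nxt j)) ?next_mem // big1 // => i /andP[iT ij].
apply/eqP; rewrite eqb0; apply/negP => desc.
have aij : (a i <= a j)%N := jmax i iT.
(* A second descent, from [i] to [i'], leaves [j] outside the stretch between them; each possible
   place of [j] contradicts the position of [t]. *)
have := next_enum_ord iT jT; rewrite /= -/nxt; move: (nxt i) desc => i' desc.
have nij : i != j :> nat by [].
have [ii'|i'i] := ltnP i i'.
  have [_] := tP i i' ii'; rewrite ltnNge desc => /esym/negbFE/andP[it ti'].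
  case/orP => [ji|i'j].
    have lt_ji : (j < i)%N by rewrite ltn_neqAle eq_sym nij.
    by have [_] := tP j i lt_ji; rewrite ltnNge aij (leqNgt t) it andbF.
  have [E _] := tP i j (leq_trans ii' i'j).
  by rewrite it (leq_trans ti' i'j) ltnNge aij in E.
case/andP => i'j ji.
have lt_ji : (j < i)%N by rewrite ltn_neqAle eq_sym nij.
have [_] := tP j i lt_ji; rewrite ltnNge aij => /esym/negbFE/andP[jt ti].
have [E _] := tP i' i (leq_ltn_trans i'j lt_ji).
by rewrite ti (leq_ltn_trans i'j jt) ltnNge desc in E.
Qed.

(* Pointwise, [x] in gap plus [x] in interval equals [a i <= x] minus
   [a (nxt i) <= x] plus a descent indicator; the first two telescope. *)
Lemma sum_gap_interval x :
  (\sum_(i in T) ((x \in gap i) + (x \in I i)) = 1)%N.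
Proof.
have nxt_inj : injective nxt := can_inj (prev_next (enum_uniq T)).
have : (\sum_(i in T) ((x \in gap i) + (x \in I i))
        + \sum_(i in T) (a (nxt i) <= x)
        = \sum_(i in T) (a i <= x) + \sum_(i in T) (a (nxt i) <= a i))%N.
  rewrite -!big_split /=; apply: eq_bigr => i iT.
  rewrite /gap /cyc_open_interval in_setC !mem_cyc_interval.
  have [E|ni] := eqVneq (nxt i) i; first by rewrite E; lia.
  have := interval_notin ni (start_mem _); have := interval_notin ni (stop_mem _).
  rewrite eq_sym in ni.
  have := interval_notin ni (start_mem _); have := interval_notin ni (stop_mem _).
  by rewrite !mem_cyc_interval; lia.
rewrite sum_descents.
have -> : (\sum_(i in T) (a i <= x) = \sum_(i in T) (a (nxt i) <= x))%N.
  by rewrite (reindex_inj nxt_inj); apply: eq_bigl => i; rewrite next_mem.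
by lia.
Qed.

Lemma gap_interval_disj i k x : i \in T -> k \in T -> x \in gap i -> x \notin I k.
Proof.
move=> iT kT xi; apply/negP => xk; have := sum_gap_interval x.
by rewrite big_split /= (bigD1 i) //= xi [X in (_ + X)%N](bigD1 k) //= xk; lia.
Qed.

(** Double counting of [B], each point lying in exactly one gap or interval of the block. This turns
    a rank minus gap sizes into the number of basis elements in the block. *)
Lemma card_gap_interval (B : {set 'I_n}) :
  (\sum_(i in T) #|B :&: gap i| + \sum_(i in T) #|B :&: I i| = #|B|)%N.
Proof.
have cardI (J : {set 'I_n}) : #|B :&: J| = (\sum_(x in B) (x \in J))%N.
  rewrite -sum1_card big_mkcond [RHS]big_mkcond /=.
  by apply: eq_bigr => x _; rewrite inE; case: (x \in B) => //=; case: (x \in J).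
under eq_bigr do rewrite cardI; under [X in (_ + X)%N]eq_bigr do rewrite cardI.
rewrite -big_split /=; under eq_bigr do rewrite -big_split /=.
rewrite exchange_big /= -sum1_card; apply: eq_bigr => x _.
exact: sum_gap_interval.
Qed.

End Block.
End CyclicIntervals.

(** * Classes of intervals linked by exchange edges *)

Section Links.
Variables (n s : nat) (a b : 'I_s -> 'I_n).
Hypothesis ab_disj : forall i j : 'I_s, i != j ->
  [disjoint cyc_interval (a i) (b i) & cyc_interval (a j) (b j)].
Hypothesis ab_cyc :
  cyclically_ordered (flatten [seq [:: a i; b i] | i <- enum 'I_s]).
Variable e : rel 'I_n.
Hypothesis e_crossing : forall x1 y1 x2 y2,
  e x1 y1 -> e x2 y2 -> crossing x1 y1 x2 y2 -> e x1 y2.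

Let I i := cyc_interval (a i) (b i).

Definition link : rel 'I_s := fun i j =>
  [exists x in I i, exists y in I j, e x y || e y x].

Lemma linkP i j x y : x \in I i -> y \in I j -> e x y || e y x -> link i j.
Proof.
by move=> xi yj exy; apply/existsP; exists x; rewrite xi; apply/existsP; exists y; rewrite yj.
Qed.

Lemma link_sym : symmetric link.
Proof.
by move=> i j; apply/idP/idP => /exists_inP[x xi /exists_inP[y yj]];
  rewrite orbC; apply: linkP.
Qed.

Lemma link_connect_sym : connect_sym link.
Proof. exact: sym_connect_sym link_sym. Qed.

Lemma link_connect_equiv : equivalence_rel (connect link).
Proof.
move=> i j k; split=> [|ij]; first exact: connect0.
exact: (same_connect link_connect_sym ij).
Qed.

(** A discrete Jordan argument: a path of links between intervals on opposite sides of the chord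
    contains a link that changes side, and its edge crosses the chord. *)
Lemma link_across i j u v : connect link i j -> crossing u v (a i) (a j) ->
  (forall k, connect link i k -> u \notin I k /\ v \notin I k) ->
  exists x y k l, [/\ connect link i k, connect link i l, x \in I k, y \in I l &
    e x y && crossing u v x y].
Proof.
case/connectP=> p; elim: p i => [|k p IHp] i /= => [_ ->|].
  by rewrite /crossing; case: (_ < _)%N; case: (_ < _)%N.
case/andP=> ik kp jE X uv.
have cik : connect link i k := connect1 ik.
case Xk: (crossing u v (a k) (a j)).
  have [|x [y [k' [l [ck cl xk yl exy]]]]] := IHp k kp jE Xk.
    by move=> l kl; apply/uv/(connect_trans cik).
  by exists x, y, k', l; split=> //; apply: connect_trans cik _.
have [ui vi] := uv i (connect0 _ _); have [uk vk] := uv k cik.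
case/exists_inP: ik => x xi /exists_inP[y yk exy].
(* The chord separates [i] from [j] but not [k] from [j], hence separates [i] from [k]; [x] and [y]
   lie on the sides of their intervals. *)
have Xxy : crossing u v x y.
  rewrite /crossing -addbA (interval_one_side ui vi xi) (interval_one_side uk vk yk).
  by move: X Xk; rewrite /crossing; do 6!case: (_ < _)%N.
case/orP: exy => exy; first by exists x, y, i, k; rewrite exy.
exists y, x, k, i; split=> //; rewrite exy /=.
by move: Xxy; rewrite /crossing; do 4!case: (_ < _)%N.
Qed.

(** If the classes differed, the chord between [a j1] and [a j2] would be crossed by an edge [x y]
    of the first class, and this edge in turn by an edge [z w] of the second. Then [e_crossing]
    gives the edge [x w], which links the classes. *)
Lemma crossing_connected i1 i2 j1 j2 :
  connect link i1 i2 -> connect link j1 j2 ->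
  crossing (a i1) (a i2) (a j1) (a j2) -> connect link i1 j1.
Proof.
move=> ci cj X; apply: contraT => nij.
have disj k l x y : connect link i1 k -> connect link j1 l ->
    x \in I k -> y \in I l -> x != y.
  move=> ik jl xk yl; apply: contra nij => /eqP E; rewrite E in xk.
  rewrite (mem_interval_inj ab_disj xk yl) in ik.
  by apply: connect_trans ik _; rewrite link_connect_sym.
have st k : a k \in I k := start_mem a b k.
have nI k : connect link i1 k -> a j1 \notin I k /\ a j2 \notin I k.
  move=> ik; split; apply/negP => h.
    by have := disj k j1 _ _ ik (connect0 _ _) h (st j1); rewrite eqxx.
  by have := disj k j2 _ _ ik cj h (st j2); rewrite eqxx.
have X' : crossing (a j1) (a j2) (a i1) (a i2).
  rewrite -crossing_sym //.
  - exact: disj (connect0 _ _) (connect0 _ _) (st _) (st _).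
  - exact: disj (connect0 _ _) cj (st _) (st _).
  - exact: disj ci (connect0 _ _) (st _) (st _).
  - exact: disj ci cj (st _) (st _).
have [x [y [k [l [ik il xk yl /andP[exy Xxy]]]]]] := link_across ci X' nI.
have Xyx : crossing x y (a j1) (a j2).
  rewrite crossing_sym //.
  - exact: disj ik (connect0 _ _) xk (st _).
  - exact: disj ik cj xk (st _).
  - exact: disj il (connect0 _ _) yl (st _).
  - exact: disj il cj yl (st _).
have nJ m : connect link j1 m -> x \notin I m /\ y \notin I m.
  move=> jm; split; apply/negP => h.
    by have := disj k m _ _ ik jm xk h; rewrite eqxx.
  by have := disj l m _ _ il jm yl h; rewrite eqxx.
have [z [w [k' [l' [_ jl' _ wl /andP[ezw Xzw]]]]]] := link_across cj Xyx nJ.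
have exw := e_crossing exy ezw Xzw.
have kl : link k l' by apply: linkP xk wl _; rewrite exw.
apply: contraNT nij => _; apply: connect_trans ik _.
by apply: connect_trans (connect1 kl) _; rewrite link_connect_sym.
Qed.

Lemma no_edge_into_gap (T : {set 'I_s}) i x y :
  (forall k l, k \in T -> (l \in T) = connect link k l) -> i \in T ->
  (forall k x y, y \in I k -> e x y -> exists l, x \in I l) ->
  x \in gap a b T i -> y \notin gap a b T i -> ~~ e x y.
Proof.
move=> T_class iT e_closed xg yg; apply/negP => exy.
have T_neq0 : T != set0 by apply/set0Pn; exists i.
have xT k : k \in T -> x \notin I k.
  by move=> kT; apply: (gap_interval_disj ab_disj ab_cyc T_neq0 iT kT xg).
(* By [e_closed], an edge from [x] into the block puts [x] in some interval, which is then linked to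
   the block; but [x] lies in a gap. *)
have intoT k z : k \in T -> z \in I k -> ~~ e x z.
  move=> kT zk; apply/negP => exz; have [l xl] := e_closed k x z zk exz.
  have /xT : l \in T.
    rewrite (T_class k) // link_connect_sym; apply: connect1.
    by apply: linkP xl zk _; rewrite exz.
  by rewrite xl.
have yT k : k \in T -> y \notin I k.
  by move=> kT; apply/negP => /(intoT k y kT); rewrite exy.
have X := gap_separated ab_disj iT xT yT xg yg.
have ci : connect link i (next (enum T) i) by rewrite -T_class ?next_mem.
have [|z [w [k [l [_ il _ wl /andP[ezw Xzw]]]]]] := link_across ci X.
  by move=> k; rewrite -T_class // => kT; split; [apply: xT|apply: yT].
by rewrite -T_class // in il; have := intoT l w il wl; rewrite (e_crossing exy ezw Xzw).
Qed.

End Links.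

(** * From gap minima to the rank formula *)

Lemma min_gapE n (M : matroid n) (B : {set 'I_n}) (u v : 'I_n) :
  B \in bases M ->
  (forall C, C \in bases M ->
     (#|B :&: cyc_open_interval u v| <= #|C :&: cyc_open_interval u v|)%N) ->
  min_gap M u v = #|B :&: cyc_open_interval u v|.
Proof.
move=> BM Bmin; apply/eqP; rewrite eqn_leq; apply/andP; split.
  exact: (@Order.TotalTheory.bigmin_inf _ nat _ n B _ _
    (fun C => #|C :&: cyc_open_interval u v|) BM (leqnn _)).
apply: (big_ind (fun m => #|B :&: cyc_open_interval u v| <= m)%N).
(* The default value [n] of the iterated minimum bounds every cardinal. *)
- by apply: leq_trans (max_card _) _; rewrite card_ord.
- by move=> p q Bp Bq; rewrite leq_min Bp.
- exact: Bmin.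
Qed.

Theorem theorem4p2 (R : realType) (n : nat) (M : matroid n)
    (hpos : positroid R M)
    (hloop : forall x : 'I_n, ~ loop M x)
    (hcoloop : forall x : 'I_n, ~ coloop M x)
    (s : nat) (hs : (1 <= s)%N) (a b : 'I_s -> 'I_n)
    (hdisj : forall i j : 'I_s, i != j ->
       [disjoint cyc_interval (a i) (b i) & cyc_interval (a j) (b j)])
    (hcyc : cyclically_ordered
              (flatten [seq [:: a i; b i] | i <- enum 'I_s])) :
  exists P : {set {set 'I_s}},
    [/\ partition P [set: 'I_s],
        noncrossing P &
        (rk M (\bigcup_(i : 'I_s) cyc_interval (a i) (b i)))%:Z
          = \sum_(T in P) nbd M a b T].
Proof.
set E := \bigcup_i _.
have [B BM rkE] : {B | B \in bases M & rk M E = #|E :&: B|}.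
  by apply: eq_bigmax_cond; rewrite card_gt0 bases_neq0.
have [d dP] := positroid_card_basis hpos.
pose e : rel 'I_n := fun x y => [&& x \in B, y \notin B & y |: (B :\ x) \in bases M].
have e_crossing x1 y1 x2 y2 :
    e x1 y1 -> e x2 y2 -> crossing x1 y1 x2 y2 -> e x1 y2.
  move=> /and3P[x1B y1B e1] /and3P[x2B y2B e2] X; apply/and3P; split=> //.
  exact: (positroid_crossing_exchange hpos BM x1B x2B y1B y2B e1 e2 X).
(* An edge into [E] from outside would give a basis with one more element in [E], against the choice
   of [B]. *)
have e_closed k x y : y \in cyc_interval (a k) (b k) -> e x y ->
    exists l, x \in cyc_interval (a l) (b l).
  move=> yk /and3P[xB yB exy].
  have yE : y \in E by apply/bigcupP; exists k.
  suff /bigcupP[l _ xl] : x \in E by exists l.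
  apply: contraT => xE.
  have : (#|E :&: (y |: (B :\ x))| <= #|E :&: B|)%N.
    by rewrite -rkE; apply: (bigop.bigmax_sup (y |: (B :\ x))).
  have -> : E :&: (y |: (B :\ x)) = y |: (E :&: B).
    apply/setP => z; rewrite !inE; have [->|_] := eqVneq z y; first by rewrite yE.
    by have [->|_] := eqVneq z x; rewrite //= (negPf xE).
  by rewrite cardsU1 inE (negPf yB) andbF ltnn.
pose conn := connect (link a b e).
pose P := equivalence_partition conn [set: 'I_s].
have conn_equiv : {in [set: 'I_s] & &, equivalence_rel conn}.
  by move=> i j k _ _ _; apply: link_connect_equiv.
have P_part : partition P [set: 'I_s] by apply: equivalence_partitionP.
have P_class T i j : T \in P -> i \in T -> (j \in T) = conn i j.
  move=> TP iT; case/and3P: P_part => _ tP _.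
  by rewrite -(def_pblock tP TP iT) pblock_equivalence_partition.
have nbdE T : T \in P ->
    nbd M a b T = (\sum_(i in T) #|B :&: cyc_interval (a i) (b i)|)%:Z.
  move=> TP.
  have T_neq0 : T != set0.
    by case/and3P: P_part => _ _; apply: contraNneq => <-.
  have rk_top : rk M [set: 'I_n] = #|B|.
    apply/eqP; rewrite eqn_leq; apply/andP; split.
      by apply/bigmax_leqP => C CM; rewrite setTI (dP C CM) (dP B BM).
    by apply: (bigop.bigmax_sup B); rewrite ?setTI.
  (* No swap moves an element of [B] out of the gap, so [basis_cap_min] makes [B] a minimizer for
     every gap at once. *)
  have gapE i : i \in T ->
      min_gap M (b i) (a (next (enum T) i)) = #|B :&: gap a b T i|.
    move=> iT; apply: min_gapE => // C; apply: basis_cap_min => // x y.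
    rewrite in_setI in_setU negb_or => /andP[xB xg] /andP[yB yg].
    have := no_edge_into_gap hdisj hcyc e_crossing (fun k l => P_class T k l TP) iT e_closed xg yg.
    by rewrite /e xB yB.
  rewrite /nbd rk_top (eq_bigr (fun i => #|B :&: gap a b T i|%:Z)); last first.
    by move=> i /gapE->.
  rewrite -(big_morph Posz PoszD (erefl _)).
  by rewrite -(card_gap_interval hdisj hcyc T_neq0 B) PoszD addrC addKr.
exists P; split=> //.
- move=> T U TP UP TU [x [y [z [w [xy yz zw /andP[xT zT] /andP[yU wU]]]]]].
  case/eqP: TU.
  have conn_xy : conn x y.
    apply: (crossing_connected hdisj e_crossing (i2 := z) (j2 := w)).
    + by rewrite -/conn -(P_class T).
    + by rewrite -/conn -(P_class U).
    + exact: (crossing_starts hdisj hcyc xy yz zw).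
  rewrite -(P_class T) // in conn_xy; case/and3P: P_part => _ tP _.
  by rewrite -(def_pblock tP TP conn_xy) (def_pblock tP UP yU).
- rewrite (eq_bigr _ nbdE) -(big_morph Posz PoszD (erefl _)) rkE; congr Posz.
  (* Both sides count the elements of [B] interval by interval, the right-hand one grouping the
     intervals by block. *)
  transitivity (\sum_(i in [set: 'I_s]) #|B :&: cyc_interval (a i) (b i)|)%N; last first.
    exact: set_partition_big.
  rewrite -sum1_card (eq_bigl (fun x => (x \in E) && (x \in B))); last first.
    by move=> x; rewrite inE.
  rewrite big_mkcondr partition_disjoint_bigcup //.
  rewrite [RHS](eq_bigl xpredT) => [|i]; last by rewrite inE.
  apply: eq_bigr => i _; rewrite -big_mkcondr -sum1_card.
  by apply: eq_bigl => x; rewrite in_setI andbC.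
Qed.
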